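(* Let $(E,\top_E)$ be a pre-locality $\mathbb{K}$-vector space. There is a unique relation $\top_E^\ell$ on $E$ containing $\top_E$ such that $(E,\top_E^\ell)$ is a locality vector space and such that for any locality vector space $(F,\top_F)$ and any locality linear map $f:(E,\top_E)\to(F,\top_F)$, the map $f$ is a locality linear map from $(E,\top_E^\ell)$ to $(F,\top_F)$. The map $\mathcal{L}:\mathbf{V}_{\rm pre-loc}\to\mathbf{V}_{\rm loc}$, $(E,\top_E)\mapsto (E,\top_E^\ell)$ on the objects, combined with the identity map $\mathcal{L}(f)=f$ on the morphisms (given by locality linear maps $f$), defines a non essentially surjective functor between the two categories.
   Context: $\mathbb{K}$ is $\mathbb{R}$ or $\mathbb{C}$. A locality set is a pair $(S,\top)$ with $\top\subset S\times S$ a symmetric relation; $x\top y$ means $(x,y)\in\top$. A locality map $f:(X,\top_X)\to(Y,\top_Y)$ is a map with $(f\times f)(\top_X)\subset\top_Y$. For $U\subset S$, the polar set is $U^\top=\{x\in S: u\top x\ \forall u\in U\}$. A pre-locality vector space is a $\mathbb{K}$-vector space $V$ with a symmetric relation $\top\subset V\times V$ such that $(0,0)\in\top$. A locality vector space is a pre-locality vector space $(V,\top)$ such that $U^\top$ is a linear subspace of $V$ for every subset $U\subset V$. A locality linear map is a linear map which is a locality map. $\mathbf{V}_{\rm pre-loc}$ (resp. $\mathbf{V}_{\rm loc}$) is the category of pre-locality (resp. locality) vector spaces with locality linear maps as morphisms.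
   Formalization: The clause ''non essentially surjective'' is false if read as ''not essentially surjective'', since every locality vector space is its own completion; it is replaced by the claim that the functor is surjective on objects, up to equality. *)

(* Defs.v *)
From HB Require Import structures.
From mathcomp Require Import all_boot all_order all_algebra.
From mathcomp Require Import boolp classical_sets reals.
From mathcomp Require Import complex.

Set Implicit Arguments.
Unset Strict Implicit.
Unset Printing Implicit Defensive.

Import GRing.Theory.
Local Open Scope ring_scope.
Local Open Scope classical_set_scope.

Variant scalar_kind := RealScalars | ComplexScalars.

Definition scalars (R : realType) (k : scalar_kind) : fieldType :=
  match k with
  | RealScalars => R
  | ComplexScalars => R[i]
  end.

Definition locality_map (X Y : Type) (TX : set (X * X)) (TY : set (Y * Y))
    (f : X -> Y) : Prop :=
  [set (f p.1, f p.2) | p in TX] `<=` TY.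

Definition polar (S : Type) (T : set (S * S)) (U : set S) : set S :=
  [set x | forall u, U u -> T (u, x)].

Definition prelocality (K : fieldType) (V : lmodType K) (T : set (V * V)) :
    Prop :=
  (forall x y : V, T (x, y) -> T (y, x)) /\ T (0, 0).

Definition locality (K : fieldType) (V : lmodType K) (T : set (V * V)) : Prop :=
  prelocality T /\ forall U : set V, submod_closed (mem (polar T U)).

Record prelocVect (K : fieldType) := PrelocVect {
  preloc_space :> lmodType K;
  preloc_rel : set (preloc_space * preloc_space);
  preloc_relP : prelocality preloc_rel
}.
Arguments preloc_rel {K} p.

Record locVect (K : fieldType) := LocVect {
  loc_space :> lmodType K;
  loc_rel : set (loc_space * loc_space);
  loc_relP : locality loc_rel
}.
Arguments loc_rel {K} l.

Record locality_linear (K : fieldType) (V W : lmodType K)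
    (TV : set (V * V)) (TW : set (W * W)) := LocalityLinear {
  loclin_fun :> {linear V -> W};
  loclin_funP : locality_map TV TW loclin_fun
}.

Record category := Category {
  obj :> Type;
  arrow : obj -> obj -> Type;
  id_arrow : forall A, arrow A A;
  comp_arrow : forall A B C, arrow B C -> arrow A B -> arrow A C;
  comp_arrow_id : forall A B (f : arrow A B), comp_arrow f (id_arrow A) = f;
  comp_id_arrow : forall A B (f : arrow A B), comp_arrow (id_arrow B) f = f;
  comp_arrowA : forall A B C D (f : arrow C D) (g : arrow B C) (h : arrow A B),
    comp_arrow f (comp_arrow g h) = comp_arrow (comp_arrow f g) h
}.

Definition is_functor (C D : category) (F0 : C -> D)
    (F1 : forall A B : C, arrow A B -> arrow (F0 A) (F0 B)) : Prop :=
  (forall A : C, F1 A A (id_arrow A) = id_arrow (F0 A)) /\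
  (forall (A B E : C) (f : arrow B E) (g : arrow A B),
     F1 A E (comp_arrow f g) = comp_arrow (F1 B E f) (F1 A B g)).

Section LocalityLinearMaps.
Variable K : fieldType.

Lemma loclin_ext (V W : lmodType K) (TV : set (V * V)) (TW : set (W * W))
    (f g : locality_linear TV TW) : f =1 g -> f = g.
Proof.
move: f g => [f fP] [g gP] /= fg.
have {fg} e : f = g.
  move/funext: fg; move: f g {fP gP} => [f [[f1] [f2]]] [g [[g1] [g2]]] /= fg.
  by subst g; rewrite (Prop_irrelevance f1 g1) (Prop_irrelevance f2 g2).
by subst g; rewrite (Prop_irrelevance fP gP).
Qed.

Lemma loclin_idP (V : lmodType K) (TV : set (V * V)) :
  locality_map TV TV (idfun : {linear V -> V}).
Proof. by move=> _ [[x y] Txy <-]. Qed.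

Definition loclin_id (V : lmodType K) (TV : set (V * V)) :
    locality_linear TV TV :=
  LocalityLinear (@loclin_idP V TV).

Lemma loclin_compP (U V W : lmodType K) (TU : set (U * U)) (TV : set (V * V))
    (TW : set (W * W)) (f : locality_linear TV TW)
    (g : locality_linear TU TV) :
  locality_map TU TW (f \o g : {linear U -> W}).
Proof.
move=> _ [[x y] Txy <-]; apply: (@loclin_funP _ _ _ _ _ f).
by exists (g x, g y) => //; apply: (@loclin_funP _ _ _ _ _ g); exists (x, y).
Qed.

Definition loclin_comp (U V W : lmodType K) (TU : set (U * U))
    (TV : set (V * V)) (TW : set (W * W)) (f : locality_linear TV TW)
    (g : locality_linear TU TV) : locality_linear TU TW :=
  LocalityLinear (@loclin_compP U V W TU TV TW f g).

End LocalityLinearMaps.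

Definition prelocCat (K : fieldType) : category.
Proof.
refine (@Category (prelocVect K)
  (fun E F => locality_linear (preloc_rel E) (preloc_rel F))
  (fun E => loclin_id (preloc_rel E)) (fun E F G f g => loclin_comp f g)
  _ _ _); by move=> *; apply: loclin_ext.
Defined.

Definition locCat (K : fieldType) : category.
Proof.
refine (@Category (locVect K)
  (fun E F => locality_linear (loc_rel E) (loc_rel F))
  (fun E => loclin_id (loc_rel E)) (fun E F G f g => loclin_comp f g)
  _ _ _); by move=> *; apply: loclin_ext.
Defined.

Definition locality_completion (K : fieldType) (E : prelocVect K)
    (T : set (E * E)) : Prop :=
  [/\ preloc_rel E `<=` T,
      locality T
    & forall (F : locVect K) (f : {linear E -> F}),
        locality_map (preloc_rel E) (loc_rel F) f ->
        locality_map T (loc_rel F) f].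

Definition completed_obj (K : fieldType)
    (Tl : forall E : prelocVect K, set (E * E))
    (TlP : forall E, locality_completion (Tl E)) (E : prelocCat K) : locCat K :=
  LocVect (let: And3 _ locT _ := TlP E in locT).

(* Surjectivity up to equality of objects, not up to isomorphism as in
   essential surjectivity: a "non essentially surjective" functor is read as
   one that is surjective, and not merely essentially so.  The reading "not
   essentially surjective" fails for locality completion, which fixes every
   locality vector space. *)
Definition surjective_on_objects (C D : category) (F0 : C -> D) : Prop :=
  forall B : D, exists A : C, F0 A = B.

(* Main.v *)
Require Import Defs.
From HB Require Import structures.
From mathcomp Require Import all_boot all_order all_algebra.
From mathcomp Require Import boolp classical_sets reals.
From mathcomp Require Import complex.

(** The completed relation is the intersection of all locality relations
    containing the given one. Two stability properties make this work.
    Localities are closed under intersection, because polar sets for an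
    intersection are intersections of polar sets ([locality_bigcap]); so the
    intersection is again a locality. Localities are also closed under pullback
    along a linear map [f], because the polar set of [U] for the pullback is
    the preimage under [f] of the polar set of the image of [U]
    ([locality_preimage]). A linear map [f] from a pre-locality space to a
    locality space preserves the relations exactly when the pullback of the
    target relation contains the source relation; that pullback is then one of
    the intersected relations, so [f] preserves the completed relation too.

    A completion lies below every locality containing the original relation:
    apply its extension property to the identity map
    ([locality_completion_least]). This gives uniqueness. It also shows that a
    relation that already is a locality is its own completion
    ([locality_completion_fixed]), so every locality space is the image of
    itself, seen as a pre-locality space. Functoriality is immediate because
    the functor leaves the underlying linear maps unchanged. *)

Set Implicit Arguments.
Unset Strict Implicit.
Unset Printing Implicit Defensive.

Import GRing.Theory.
Local Open Scope ring_scope.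
Local Open Scope classical_set_scope.

Lemma submod_closed_memP (K : fieldType) (V : lmodType K) (A : set V) :
  submod_closed (mem A) <->
  A 0 /\ forall (a : K) (u v : V), A u -> A v -> A (a *: u + v).
Proof.
split=> [[A0 AL]|[A0 AL]].
  split=> [|a u v Au Av]; first by move: A0; rewrite inE.
  by have := AL a u v; rewrite !inE; apply.
by split=> [|a u v]; rewrite !inE //; apply: AL.
Qed.

(** An element is polar to [U] for the intersection iff it is polar to [U] for
    every member, and an intersection of subspaces is a subspace. *)
Lemma locality_bigcap (K : fieldType) (V : lmodType K)
    (P : set (set (V * V))) :
  (forall T, P T -> locality T) -> locality (\bigcap_(T in P) T).
Proof.
move=> PL; split; first split.
- by move=> x y Txy T PT; apply: (PL T PT).1.1; apply: Txy.
- by move=> T PT; apply: (PL T PT).1.2.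
move=> U; apply/submod_closed_memP; split=> [u Uu T PT|a x y Ux Uy u Uu T PT].
  have /submod_closed_memP[T0 _] := (PL T PT).2 U.
  exact: T0.
have /submod_closed_memP[_ TL] := (PL T PT).2 U.
by apply: (TL a x y) => // v Uv; [apply: Ux | apply: Uy].
Qed.

(** [x] is polar to [U] for the pulled-back relation iff [f x] is polar to
    [f @` U] for [T], so the polar set is the preimage of a subspace. *)
Lemma locality_preimage (K : fieldType) (V W : lmodType K)
    (f : {linear V -> W}) (T : set (W * W)) :
  locality T -> locality [set p : V * V | T (f p.1, f p.2)].
Proof.
move=> [[Tsym T00] TL]; split; first split.
- by move=> x y; apply: Tsym.
- by rewrite /= linear0.
move=> U; apply/submod_closed_memP.
have /submod_closed_memP[P0 PL] := TL (f @` U).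
split=> [u Uu|a x y Ux Uy u Uu] /=; rewrite ?linear0 ?linearP.
  by apply: P0; exists u.
apply: PL; last by exists u.
- by move=> _ [v Uv <-]; apply: Ux.
- by move=> _ [v Uv <-]; apply: Uy.
Qed.

Section Completion.
Variables (K : fieldType) (E : prelocVect K).

Lemma locality_completion_bigcap :
  locality_completion
    (\bigcap_(T in [set T | locality T /\ preloc_rel E `<=` T]) T).
Proof.
split.
- by move=> p Ep T [_]; apply.
- by apply: locality_bigcap => T [].
move=> F f fL _ [[x y] Txy <-].
apply: (Txy [set p : E * E | loc_rel F (f p.1, f p.2)]); split.
  exact: locality_preimage (loc_relP F).
by move=> p Ep; apply: fL; exists p.
Qed.

(** The identity of [E], seen as a map into the locality space [(E, S)],
    extends to [T]. *)
Lemma locality_completion_least (T S : set (E * E)) :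
  locality_completion T -> locality S -> preloc_rel E `<=` S -> T `<=` S.
Proof.
move=> [_ _ Tuniv] locS ES [x y] Txy.
have idL : locality_map (preloc_rel E) S (idfun : {linear E -> E}).
  by move=> _ [[u v] Euv <-]; apply: ES.
by apply: (Tuniv (LocVect locS) idfun idL); exists (x, y).
Qed.

Lemma locality_completion_uniq (T S : set (E * E)) :
  locality_completion T -> locality_completion S -> T = S.
Proof.
move=> cT cS; have [ET locT _] := cT; have [ES locS _] := cS.
by apply/seteqP; split; apply: locality_completion_least.
Qed.

Lemma locality_completion_fixed (T : set (E * E)) :
  locality (preloc_rel E) -> locality_completion T -> T = preloc_rel E.
Proof.
move=> locE cT; have [ET _ _] := cT.
by apply/seteqP; split=> //; apply: locality_completion_least.
Qed.

End Completion.

(** The action on morphisms: [f] followed by the inclusion of relations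
    [preloc_rel F `<=` TF] lands in a locality space, so it extends to [TE]. *)
Lemma locality_map_completion (K : fieldType) (E F : prelocVect K)
    (TE : set (E * E)) (TF : set (F * F)) (f : {linear E -> F}) :
  locality_completion TE -> locality_completion TF ->
  locality_map (preloc_rel E) (preloc_rel F) f -> locality_map TE TF f.
Proof.
move=> [_ _ Euniv] [FT locT _] fL.
by apply: (Euniv (LocVect locT)) => p /fL /FT.
Qed.

(** Objects are compared up to equality, not isomorphism: the two records share
    the space, and equal relations carry equal proofs by proof irrelevance. *)
Lemma completed_obj_surj (K : fieldType)
    (Tl : forall E : prelocVect K, set (E * E))
    (TlP : forall E, locality_completion (Tl E)) :
  surjective_on_objects (completed_obj TlP).
Proof.
case=> V T locT; exists (PrelocVect locT.1); rewrite /completed_obj.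
move: (let: And3 _ locT _ := _ in locT) => /=.
rewrite (locality_completion_fixed (E := PrelocVect locT.1) locT (TlP _)).
by move=> /= locT'; rewrite (Prop_irrelevance locT' locT).
Qed.

Theorem theorem1p8 (R : realType) (k : scalar_kind) :
  (forall E : prelocVect (scalars R k),
     exists! T : set (E * E), locality_completion T) /\
  (forall (Tl : forall E : prelocVect (scalars R k), set (E * E))
          (TlP : forall E, locality_completion (Tl E)),
     exists L1 : forall E F : prelocCat (scalars R k),
         arrow E F -> arrow (completed_obj TlP E) (completed_obj TlP F),
       [/\ forall (E F : prelocVect (scalars R k))
             (f : locality_linear (preloc_rel E) (preloc_rel F)) (x : E),
             (L1 E F f : locality_linear (Tl E) (Tl F)) x = f x,
           is_functor L1
         & surjective_on_objects (completed_obj TlP)]).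
Proof.
split=> [E|Tl TlP].
  exists (\bigcap_(T in [set T | locality T /\ preloc_rel E `<=` T]) T).
  have cE := locality_completion_bigcap E.
  by split=> // T; apply: locality_completion_uniq.
exists (fun (E F : prelocVect _)
  (f : locality_linear (preloc_rel E) (preloc_rel F)) =>
  LocalityLinear
    (locality_map_completion (TlP E) (TlP F) (loclin_funP (l := f)))).
split=> //; last exact: completed_obj_surj.
by split=> *; apply: loclin_ext.
Qed.
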